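(* Consider the problem $\mathcal{A}\ast_2\mathcal{X}=\mathcal{B}$, where $\mathcal{A}\in\mathbb{R}^{I\times J\times R\times S}$, $\mathcal{X}\in\mathbb{R}^{R\times S\times K\times L}$ and $\mathcal{B}\in\mathbb{R}^{I\times J\times K\times L}$, and the objective function $\phi_2(\mathcal{X})=\Vert\mathcal{A}\ast_2\mathcal{X}-\mathcal{B}\Vert_F^2$. Any minimizer $\bar{\mathcal{X}}\in\mathbb{R}^{R\times S\times K\times L}$ of $\phi_2$ satisfies the system $$\mathcal{A}^T\ast_2\mathcal{A}\ast_2\mathcal{X}=\mathcal{A}^T\ast_2\mathcal{B},$$ where $\mathcal{A}^T\in\mathbb{R}^{R\times S\times I\times J}$ denotes the transpose of $\mathcal{A}$. Moreover, the critical point of $\phi_2$ is $\bar{\mathcal{X}}=(\mathcal{A}^T\ast_2\mathcal{A})^{-1}\ast_2\mathcal{A}^T\ast_2\mathcal{B}$.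
   Context: The Einstein product $\ast_2$ contracts the last two indices of the left factor with the first two of the right factor: $(\mathcal{A}\ast_2\mathcal{X})_{ijkl}=\sum_{r,s}a_{ijrs}x_{rskl}$. The transpose of $\mathcal{A}\in\mathbb{R}^{I\times J\times R\times S}$ is $(\mathcal{A}^T)_{rsij}=a_{ijrs}$. For $\mathcal{M}\in\mathbb{R}^{R\times S\times R\times S}$, $\mathcal{M}^{-1}$ denotes the inverse with respect to $\ast_2$: $\mathcal{M}\ast_2\mathcal{M}^{-1}=\mathcal{M}^{-1}\ast_2\mathcal{M}=\mathcal{I}$, where $\mathcal{I}$ has entry $\delta_{rr'}\delta_{ss'}$ in position $(r,s,r',s')$. The Frobenius norm $\Vert\cdot\Vert_F$ is the square root of the sum of squares of all entries. A critical point of a continuously differentiable function is a point where its gradient vanishes. *)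

(* Defs.v *)
From HB Require Import structures.
From mathcomp Require Import all_boot all_order all_algebra.
From mathcomp Require Import all_classical all_reals all_analysis.
Import Order.TTheory GRing.Theory Num.Theory.
Import numFieldNormedType.Exports.

Set Implicit Arguments.
Unset Strict Implicit.
Unset Printing Implicit Defensive.

Local Open Scope ring_scope.

Definition tensor4 (R : Type) (m n p q : nat) : Type :=
  'I_m -> 'I_n -> 'I_p -> 'I_q -> R.

Definition einstein2 (R : realType) (m n p q k l : nat)
    (A : tensor4 R m n p q) (X : tensor4 R p q k l) : tensor4 R m n k l :=
  fun i j c d => \sum_(r < p) \sum_(s < q) A i j r s * X r s c d.

Notation "A *_2 X" := (einstein2 A X)
  (at level 40, left associativity) : ring_scope.

Definition ttr (R : Type) (m n p q : nat) (A : tensor4 R m n p q) :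
    tensor4 R p q m n :=
  fun r s i j => A i j r s.

Definition tid (R : realType) (p q : nat) : tensor4 R p q p q :=
  fun r s r' s' => (r == r')%:R * (s == s')%:R.

Arguments tid R p q : clear implicits.

(* [is_tinv M N] reads N = M^-1; such an N is unique when it exists. *)
Definition is_tinv (R : realType) (p q : nat) (M N : tensor4 R p q p q) : Prop :=
  M *_2 N = tid R p q /\ N *_2 M = tid R p q.

Definition tsub (R : realType) (m n k l : nat) (A B : tensor4 R m n k l) :
    tensor4 R m n k l :=
  fun i j c d => A i j c d - B i j c d.

Definition frobenius (R : realType) (m n k l : nat) (A : tensor4 R m n k l) : R :=
  Num.sqrt (\sum_(i < m) \sum_(j < n) \sum_(c < k) \sum_(d < l) A i j c d ^+ 2).

Definition phi2 (R : realType) (m n p q k l : nat) (A : tensor4 R m n p q)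
    (B : tensor4 R m n k l) (X : tensor4 R p q k l) : R :=
  frobenius (tsub (A *_2 X) B) ^+ 2.

Definition minimizer (R : realType) (T : Type) (f : T -> R) (x : T) : Prop :=
  forall y, f x <= f y.

(* [tshift X r s c d t] adds t to the entry (r, s, c, d) of X, so that
   [t |-> f (tshift X r s c d t)] has the partial derivative of f at X in that
   entry as its derivative at 0. *)
Definition tshift (R : realType) (p q k l : nat) (X : tensor4 R p q k l)
    (r : 'I_p) (s : 'I_q) (c : 'I_k) (d : 'I_l) (t : R) : tensor4 R p q k l :=
  fun r' s' c' d' => X r' s' c' d' +
    (if [&& r' == r, s' == s, c' == c & d' == d] then t else 0).

Definition gradient (R : realType) (p q k l : nat) (f : tensor4 R p q k l -> R)
    (X : tensor4 R p q k l) : tensor4 R p q k l :=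
  fun r s c d => derive1 (fun t : R => f (tshift X r s c d t)) 0.

(* [derive1] is total, so existence of the partial derivatives is required
   separately. *)
Definition critical_point (R : realType) (p q k l : nat)
    (f : tensor4 R p q k l -> R) (X : tensor4 R p q k l) : Prop :=
  (forall r s c d, derivable (fun t : R => f (tshift X r s c d t)) 0 1) /\
  (forall r s c d, gradient f X r s c d = 0).

(* Main.v *)
(** Along each coordinate direction the objective is a quadratic polynomial
    [phi2 X + t * g + t^2 * q], where [g] is twice the corresponding entry of the
    residual [A^T A X - A^T B] of the normal equations.  Hence the gradient of
    the objective is twice that residual, and a minimizer, being at the bottom
    of each of these parabolas, has zero residual. *)
Require Import Defs.
From mathcomp Require Import all_boot all_order all_algebra.
From mathcomp Require Import all_classical all_reals all_analysis.
From mathcomp Require Import ring lra.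
Import Order.TTheory GRing.Theory Num.Theory.

Set Implicit Arguments.
Unset Strict Implicit.
Unset Printing Implicit Defensive.

Local Open Scope ring_scope.

Lemma tensor4_ext (T : Type) (m n p q : nat) (A B : tensor4 T m n p q) :
  (forall i j r s, A i j r s = B i j r s) -> A = B.
Proof.
move=> eqAB; apply: funext => i; apply: funext => j.
by apply: funext => r; apply: funext => s.
Qed.

Lemma sum2_delta (V : nmodType) (m n : nat) (i0 : 'I_m) (j0 : 'I_n)
    (F : 'I_m -> 'I_n -> V) :
  \sum_(i < m) \sum_(j < n) (if (i == i0) && (j == j0) then F i j else 0) =
  F i0 j0.
Proof.
rewrite (bigD1 i0) //= (bigD1 j0) //= !eqxx /=.
rewrite big1 ?addr0 => [|j /negPf->//].
by rewrite big1 ?addr0 // => i /negPf->; rewrite big1.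
Qed.

(** At [t = - b / (e + 1)] the polynomial takes the value [- (b / (e + 1)) ^+ 2], which can only be
    nonnegative if [b = 0]. Dividing by [e + 1] instead of [2 * e] also covers [e = 0]. *)
Lemma quadratic_ge0_linear_coef (R : realFieldType) (b e : R) : 0 <= e ->
  (forall t, 0 <= t * b + t ^+ 2 * e) -> b = 0.
Proof.
move=> e0 /(_ (- b / (e + 1))).
have e1 : 0 < e + 1 by lra.
have -> : - b / (e + 1) * b + (- b / (e + 1)) ^+ 2 * e = - (b / (e + 1)) ^+ 2.
  by field; lra.
rewrite oppr_ge0 => b_le0; apply/eqP.
have := sqr_ge0 (b / (e + 1)) => b_ge0.
have /eqP : (b / (e + 1)) ^+ 2 = 0 by lra.
by rewrite sqrf_eq0 mulf_eq0 invr_eq0 (gt_eqF e1) orbF.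
Qed.

Lemma is_derive_quadratic (R : realType) (a b e : R) :
  is_derive (0 : R) 1 (fun t : R => a + t * b + t ^+ 2 * e) b.
Proof.
(* The sum and product rules supply a derivative; what remains is that its value at 0 equals [b]. *)
apply: is_derive_eq.
by rewrite /GRing.scale /=; ring.
Qed.

Section Einstein.
Variable R : realType.

Lemma einstein2A (a b c d e f g h : nat) (A : tensor4 R a b c d)
    (B : tensor4 R c d e f) (C : tensor4 R e f g h) :
  A *_2 B *_2 C = A *_2 (B *_2 C).
Proof.
apply: tensor4_ext => i j k l; rewrite /einstein2 !pair_bigA /=.
under eq_bigr do rewrite pair_bigA /= big_distrl /=.
under [RHS]eq_bigr do rewrite pair_bigA /= big_distrr /=.
rewrite exchange_big /=; apply: eq_bigr => u _; apply: eq_bigr => v _.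
by rewrite mulrA.
Qed.

Lemma einstein2_tidl (p q k l : nat) (X : tensor4 R p q k l) :
  tid R p q *_2 X = X.
Proof.
apply: tensor4_ext => r s c d; rewrite /einstein2 /tid.
rewrite -[RHS](sum2_delta r s (fun r s => X r s c d)).
apply: eq_bigr => u _; apply: eq_bigr => v _.
by rewrite (eq_sym u) (eq_sym v); do 2 case: eqP => _;
  rewrite /= ?mul0r ?mul1r ?mul0r.
Qed.

(** By linearity, the perturbation only reaches the slice [(c, d)] of the product, where it adds [t]
    times the slice [(r, s)] of [A]. *)
Lemma einstein2_tshift (m n p q k l : nat) (A : tensor4 R m n p q)
    (X : tensor4 R p q k l) r s c d t i j c' d' :
  (A *_2 tshift X r s c d t) i j c' d' = (A *_2 X) i j c' d' +
    (if (c' == c) && (d' == d) then A i j r s * t else 0).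
Proof.
rewrite /einstein2 /tshift.
(* The correction is spread into a sum over the contracted indices, so that both sides can be
   compared term by term. *)
rewrite -(sum2_delta r s
  (fun u v => if (c' == c) && (d' == d) then A i j u v * t else 0)).
rewrite -big_split /=; apply: eq_bigr => u _.
rewrite -big_split /=; apply: eq_bigr => v _.
rewrite mulrDr; congr (_ + _).
by case: (u == r); case: (v == s); case: (c' == c); case: (d' == d);
  rewrite /= ?mulr0.
Qed.

Lemma frobenius_sqr (m n k l : nat) (A : tensor4 R m n k l) :
  frobenius A ^+ 2 =
  \sum_(i < m) \sum_(j < n) \sum_(c < k) \sum_(d < l) A i j c d ^+ 2.
Proof.
by rewrite sqr_sqrtr //; do 4 (apply: sumr_ge0 => ? _); exact: sqr_ge0.
Qed.

Variables (m n p q k l : nat) (A : tensor4 R m n p q) (B : tensor4 R m n k l).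
Implicit Type X : tensor4 R p q k l.

(** The factored form is the one in which the cross term of the expanded square appears. *)
Definition normal_residual X : tensor4 R p q k l :=
  ttr A *_2 tsub (A *_2 X) B.

Lemma normal_residualE X r s c d :
  normal_residual X r s c d =
  (ttr A *_2 A *_2 X) r s c d - (ttr A *_2 B) r s c d.
Proof.
rewrite einstein2A /normal_residual {1 3 5}/einstein2 -sumrB.
apply: eq_bigr => i _; rewrite -sumrB; apply: eq_bigr => j _.
by rewrite /tsub mulrBr.
Qed.

Lemma normal_equationP X :
  (forall r s c d, normal_residual X r s c d = 0) <->
  ttr A *_2 A *_2 X = ttr A *_2 B.
Proof.
split=> [res0|eqX r s c d]; last by rewrite normal_residualE eqX subrr.
apply: tensor4_ext => r s c d.
by apply/eqP; rewrite -subr_eq0 -normal_residualE res0.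
Qed.

Lemma phi2_tshift X r s c d t :
  phi2 A B (tshift X r s c d t) =
  phi2 A B X + t * (2 * normal_residual X r s c d) +
  t ^+ 2 * \sum_(i < m) \sum_(j < n) A i j r s ^+ 2.
Proof.
rewrite /phi2 !frobenius_sqr /normal_residual {3}/einstein2 !mulr_sumr.
rewrite -!big_split /=; apply: eq_bigr => i _.
rewrite !mulr_sumr -!big_split /=; apply: eq_bigr => j _.
rewrite /ttr; set E := tsub (A *_2 X) B.
(* For fixed [i] and [j], only the entry [(c, d)] of [E] moves, by [A i j r s * t]; the indicator
   isolates the linear and quadratic terms of its square. *)
transitivity (\sum_(c' < k) \sum_(d' < l) (E i j c' d' ^+ 2 +
    (if (c' == c) && (d' == d) then
       t * (2 * (A i j r s * E i j c' d')) + t ^+ 2 * A i j r s ^+ 2 else 0))).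
  apply: eq_bigr => c' _; apply: eq_bigr => d' _.
  rewrite /E /tsub einstein2_tshift.
  by case: ifP => _; ring.
rewrite -addrA -(sum2_delta c d
  (fun u v => t * (2 * (A i j r s * E i j u v)) + t ^+ 2 * A i j r s ^+ 2)).
by rewrite -big_split /=; apply: eq_bigr => u _; rewrite -big_split.
Qed.

(** [is_derive] provides both halves of [critical_point]: existence of the partial derivative and
    its value. *)
Lemma is_derive_phi2_tshift X r s c d :
  is_derive (0 : R) 1 (fun t : R => phi2 A B (tshift X r s c d t))
    (2 * normal_residual X r s c d).
Proof.
by rewrite (funext (phi2_tshift X r s c d)); exact: is_derive_quadratic.
Qed.

Lemma critical_point_phi2 X :
  critical_point (phi2 A B) X <-> ttr A *_2 A *_2 X = ttr A *_2 B.
Proof.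
have gradE r s c d :
    gradient (phi2 A B) X r s c d = 2 * normal_residual X r s c d.
  by rewrite /gradient derive1E; have [] := is_derive_phi2_tshift X r s c d.
rewrite -normal_equationP; split=> [[_ grad0] r s c d|res0].
  by have := grad0 r s c d; rewrite gradE; lra.
split=> r s c d; last by rewrite gradE res0 mulr0.
by have [] := is_derive_phi2_tshift X r s c d.
Qed.

(** No derivative is taken: comparing [X] with its shifts gives a nonnegative parabola vanishing at
    0, whose leading coefficient is a sum of squares. *)
Lemma minimizer_phi2_normal_equation X :
  minimizer (phi2 A B) X -> ttr A *_2 A *_2 X = ttr A *_2 B.
Proof.
move=> minX; apply/normal_equationP => r s c d.
suff : 2 * normal_residual X r s c d = 0 by lra.
apply: (@quadratic_ge0_linear_coef _ _ (\sum_(i < m) \sum_(j < n) A i j r s ^+ 2)).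
  by do 2 (apply: sumr_ge0 => ? _); exact: sqr_ge0.
by move=> t; have := minX (tshift X r s c d t); rewrite phi2_tshift; lra.
Qed.

End Einstein.

Theorem lemma6p3 (R : realType) (nI nJ nR nS nK nL : nat)
    (A : tensor4 R nI nJ nR nS) (B : tensor4 R nI nJ nK nL) :
  (forall Xbar : tensor4 R nR nS nK nL, minimizer (phi2 A B) Xbar ->
     ttr A *_2 A *_2 Xbar = ttr A *_2 B) /\
  (forall N : tensor4 R nR nS nR nS, is_tinv (ttr A *_2 A) N ->
     forall Xbar : tensor4 R nR nS nK nL,
       critical_point (phi2 A B) Xbar <-> Xbar = N *_2 ttr A *_2 B).
Proof.
split=> [X|N [MN NM] X]; first exact: minimizer_phi2_normal_equation.
(* Solving the normal equations for [X] uses that [N] is a left inverse; checking that the formula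
   solves them uses that it is a right inverse. *)
rewrite critical_point_phi2 (einstein2A N); split=> [<-|->].
  by rewrite -einstein2A NM einstein2_tidl.
by rewrite -einstein2A MN einstein2_tidl.
Qed.
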